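(* Let $R=\mathbb{Z}_m$, where $m$ has prime factorization $m=p_1^{e_1}\cdots p_k^{e_k}$ (distinct primes $p_i$, $e_i\ge 1$). Then a finite edge-labeled graph $(G,\alpha)$ over $R$ has rank one if and only if $G$ contains spanning trees $T_1,\dots,T_k$ such that every edge label of $T_i$ is contained in the ideal $(p_i^{e_i})$ of $\mathbb{Z}_m$, for each $i=1,\dots,k$. (The $T_i$ need not be edge-disjoint or even distinct.)
   Context: An edge labeling of a graph $G=(V,E)$ over a commutative ring $R$ is a function $\alpha:E\to I(R)$ to the set of ideals of $R$. A spline on $(G,\alpha)$ is a function $p:V\to R$ with $p(u)-p(v)\in\alpha(uv)$ for every edge $uv$. A constant spline takes the same value at every vertex. $(G,\alpha)$ has rank one if it admits only constant splines. *)

(* Defs.v *)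
From mathcomp Require Import all_boot all_algebra.

Set Implicit Arguments.
Unset Strict Implicit.
Unset Printing Implicit Defensive.

Import GRing.Theory.
Local Open Scope ring_scope.

(* The ideals of ring_quotient (idealr, proper_ideal) are proper by definition,
   whereas an edge label may be the unit ideal. *)
Record ideal (R : comPzRingType) := Ideal {
  ideal_mem :> R -> Prop;
  ideal_mem0 : ideal_mem 0;
  ideal_memD : forall x y, ideal_mem x -> ideal_mem y -> ideal_mem (x + y);
  ideal_memMl : forall a x, ideal_mem x -> ideal_mem (a * x)
}.

Definition ideal_sub (R : comPzRingType) (I J : ideal R) : Prop :=
  forall x, I x -> J x.

Section PrincipalIdeal.

Variables (R : comPzRingType) (a : R).

Definition principal_mem (x : R) : Prop := exists y, x = y * a.

Lemma principal_mem0 : principal_mem 0.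
Proof. by exists 0; rewrite mul0r. Qed.

Lemma principal_memD x y :
  principal_mem x -> principal_mem y -> principal_mem (x + y).
Proof. by move=> [b ->] [c ->]; exists (b + c); rewrite mulrDl. Qed.

Lemma principal_memMl b x : principal_mem x -> principal_mem (b * x).
Proof. by move=> [c ->]; exists (b * c); rewrite mulrA. Qed.

Definition principal_ideal : ideal R :=
  Ideal principal_mem0 principal_memD principal_memMl.

End PrincipalIdeal.

Record sgraph (V : finType) := SGraph {
  edges : {set {set V}};
  card_edges : forall e, e \in edges -> #|e| = 2%N
}.

Definition edge (V : finType) (G : sgraph V) : Type :=
  {e : {set V} | e \in edges G}.

Definition adj (V : finType) (G : sgraph V) : rel V :=
  [rel u v | [set u; v] \in edges G].

Definition connected_graph (V : finType) (G : sgraph V) : Prop :=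
  forall u v, connect (adj G) u v.

(* A ucycle of size 2 only runs back and forth along a single edge. *)
Definition acyclic_graph (V : finType) (G : sgraph V) : Prop :=
  forall c : seq V, (2 < size c)%N -> ~ ucycle (adj G) c.

Definition is_tree (V : finType) (G : sgraph V) : Prop :=
  connected_graph G /\ acyclic_graph G.

(* T spans because it has the same vertex type V as G. *)
Definition spanning_tree (V : finType) (G T : sgraph V) : Prop :=
  edges T \subset edges G /\ is_tree T.

Definition edge_labeling (V : finType) (G : sgraph V) (R : comPzRingType) :
  Type := edge G -> ideal R.

Definition is_spline (V : finType) (G : sgraph V) (R : comPzRingType)
    (alpha : edge_labeling G R) (p : V -> R) : Prop :=
  forall (e : edge G) (u v : V), val e = [set u; v] -> alpha e (p u - p v).

Definition constant_spline (V : finType) (R : comPzRingType) (p : V -> R) :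
  Prop := forall u v, p u = p v.

Definition rank_one (V : finType) (G : sgraph V) (R : comPzRingType)
    (alpha : edge_labeling G R) : Prop :=
  forall p : V -> R, is_spline alpha p -> constant_spline p.

(* Main.v *)
(* Rank one forces, for each i, the subgraph of edges whose label lies in
   (p_i^e_i) to be connected: otherwise m/p_i times the indicator of one of its
   components is a nonconstant spline, because an ideal of Z_m not contained in
   (p_i^e_i) contains m/p_i.  A minimal connected set of edges is then a tree.
   Conversely, along T_i all differences of a spline lie in (p_i^e_i), and the
   intersection of these ideals over i is 0. *)
Require Import Defs.
From mathcomp Require Import all_boot all_algebra boolp.

Set Implicit Arguments.
Unset Strict Implicit.
Unset Printing Implicit Defensive.

Import GRing.Theory.
Local Open Scope ring_scope.

(** The enumeration has no repetitions, so each factor is coprime to the product of the later ones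
    and Gauss's lemma applies. *)
Lemma prod_dvdn_coprime (I : finType) (F : I -> nat) (n : nat) :
  (forall i j, i != j -> coprime (F i) (F j)) ->
  (forall i, F i %| n)%N -> (\prod_i F i %| n)%N.
Proof.
move=> coF dvdF; elim: (index_enum I) (index_enum_uniq I) => [|i r IHr] /=.
  by rewrite big_nil dvd1n.
case/andP=> nri /IHr dvdr; rewrite big_cons Gauss_dvd ?dvdF //.
rewrite big_seq; apply: (big_ind (coprime (F i))) => [|x y cox coy|j rj].
- exact: coprimen1.
- by rewrite coprimeMr cox.
- by apply: coF; apply: contraNneq nri => ->.
Qed.

Section ZpIdeals.

Variable m : nat.
Hypothesis m_gt1 : (1 < m)%N.

Lemma Zp_natr_eq (a b : nat) : (a%:R = b%:R :> 'Z_m) <-> (a = b %[mod m])%N.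
Proof.
split=> [/(congr1 val)|eq_ab]; first by rewrite /= !val_Zp_nat.
by apply: val_inj; rewrite /= !val_Zp_nat.
Qed.

(** By Bezout, [x] and [gcdn x m] generate the same ideal modulo [m]. *)
Lemma principal_natrP (n x : nat) :
  principal_ideal (x%:R : 'Z_m) n%:R <-> (gcdn x m %| n)%N.
Proof.
split=> [[y] | /dvdnP[b ->]].
  rewrite -[y]natr_Zp -natrM => /Zp_natr_eq/(congr1 (dvdn (gcdn x m))).
  rewrite /dvdn !modn_dvdm ?dvdn_gcdr // => ->.
  by rewrite -/(dvdn _ _) dvdn_mull ?dvdn_gcdl.
case: (posnP x) => [->|x_gt0].
  by rewrite gcd0n; exists 0; rewrite mul0r natrM pchar_Zp ?mulr0.
case: (egcdnP m x_gt0) => u v def_g _; exists (b * u)%:R.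
rewrite -natrM -mulnA def_g; apply/Zp_natr_eq.
by rewrite mulnDr mulnA modnMDl gcdnC.
Qed.

Lemma principal_dvdnP (d : nat) (x : 'Z_m) :
  (d %| m)%N -> principal_ideal (d%:R : 'Z_m) x <-> (d %| x)%N.
Proof.
by move=> /gcdn_idPl def_d; rewrite -{1}[x]natr_Zp principal_natrP def_d.
Qed.

Lemma Zp_dvdn_eq0 (x : 'Z_m) : (m %| x)%N -> x = 0.
Proof.
have := ltn_ord x; rewrite [X in (_ < X)%N -> _]Zp_cast // => x_m m_x.
by apply: val_inj; apply/eqP; rewrite /= -(modn_small x_m).
Qed.

(** Some [x] in [I] is not divisible by [p ^ e]; its gcd with [m] then divides [m %/ p], which makes
    [m %/ p] a multiple of [x] modulo [m]. *)
Lemma ideal_natr_div_prime (p e : nat) (I : ideal 'Z_m) :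
  prime p -> (p ^ e %| m)%N ->
  ~ ideal_sub I (principal_ideal ((p ^ e)%N%:R : 'Z_m)) ->
  I (m %/ p)%N%:R.
Proof.
move=> p_pr pe_m /existsNP[x /not_implyP[Ix]].
rewrite principal_dvdnP // => /negP pe_x.
suff: principal_ideal ((x : nat)%:R : 'Z_m) (m %/ p)%N%:R.
  by rewrite natr_Zp => -[a ->]; apply: ideal_memMl.
apply/principal_natrP; set g := gcdn x m.
have /dvdnP[h def_m] : (g %| m)%N by apply: dvdn_gcdr.
have /dvdnP[b def_h] : (p %| h)%N; last first.
  rewrite [X in (X %/ p)%N]def_m def_h mulnAC mulnK ?prime_gt0 //.
  exact: dvdn_mull.
(* If [p] did not divide the cofactor [h], then [p ^ e], a divisor of [m = h * g], would divide [g]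
   and hence [x]. *)
apply: contraNT pe_x => p_h.
have: (p ^ e %| g)%N.
  by rewrite -(@Gauss_dvdr _ h) -?def_m // coprimeXl ?prime_coprime.
by move/dvdn_trans; apply; apply: dvdn_gcdl.
Qed.

End ZpIdeals.

Section EdgeSets.

Variable V : finType.
Implicit Type S : {set {set V}}.

(** This is [adj] on a bare set of edges, so that edges can be removed without rebuilding an
    [sgraph]. *)
Definition edge_rel S : rel V := [rel u v | [set u; v] \in S].

Lemma edge_rel_connect_sym S : connect_sym (edge_rel S).
Proof. by apply: sym_connect_sym => u v; rewrite /edge_rel /= setUC. Qed.

Definition connected_set : pred {set {set V}} :=
  [pred S | [forall u, forall v, connect (edge_rel S) u v]].

Lemma connected_setP S :
  reflect (forall u v, connect (edge_rel S) u v) (connected_set S).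
Proof. by apply: (iffP forallP) => cS u; apply/forallP. Qed.

(** The rest of the cycle leads from [y] back to [x] and can replace the removed edge in any
    path. *)
Lemma cycle_edge_redundant S (x y z : V) (s : seq V) :
  ucycle (edge_rel S) [:: x, y, z & s] -> connected_set S ->
  connected_set (S :\ [set x; y]).
Proof.
rewrite /edge_rel; case/andP=> /= /and3P[_ Syz Szx].
rewrite !inE !negb_or => /and3P[/and3P[xNy xNz xs] /andP[yNz ys] _].
move/connected_setP=> cS; apply/connected_setP; move: cS.
rewrite /edge_rel; set S' := S :\ _ => cS.
have S'yx : connect [rel u v | [set u; v] \in S'] y x.
  apply: (@connect_trans _ _ z).
    apply: connect1; rewrite /= !inE Syz andbT.
    apply/eqP=> /setP/(_ z); rewrite !inE eqxx orbT.
    by rewrite ![z == _]eq_sym (negPf xNz) (negPf yNz).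
  (* The cycle has distinct vertices, so its stretch from [z] to [x] avoids [y] and cannot use the
     edge [[set x; y]]. *)
  apply/connectP; exists (rcons s x); last by rewrite last_rcons.
  apply: (@sub_in_path _ (predC1 y)) Szx => [a b|].
    rewrite !inE /= => aNy bNy Sab; rewrite !inE Sab andbT.
    apply/eqP=> /setP/(_ y); rewrite !inE eqxx orbT.
    by rewrite ![y == _]eq_sym (negPf aNy) (negPf bNy).
  rewrite /= all_rcons /= xNy eq_sym yNz /=.
  by apply/allP=> a sa; apply: contraNneq ys => <-.
move=> u v; apply: connect_sub (cS u v) => a b /= Sab.
have [eq_ab|neq_ab] := eqVneq [set a; b] [set x; y]; last first.
  by apply: connect1; rewrite /= !inE neq_ab.
have: a \in [set x; y] by rewrite -eq_ab set21.
have: b \in [set x; y] by rewrite -eq_ab set22.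
rewrite !inE.
by do 2!case/pred2P=> ->; rewrite ?connect0 ?S'yx // edge_rel_connect_sym.
Qed.

(** An inclusion-minimal connected subset of [S] has no cycle, since any cycle would contain a
    removable edge. *)
Lemma spanning_tree_exists (G : sgraph V) S :
  S \subset edges G -> connected_set S ->
  exists2 T, spanning_tree G T & edges T \subset S.
Proof.
move=> sSG /minset_exists[A /minsetP[cA minA] sAS].
have sAG := subset_trans sAS sSG.
have cardA (f : {set V}) : f \in A -> #|f| = 2.
  by move/(subsetP sAG)/card_edges.
exists (SGraph cardA) => //; split=> //; split; first exact/connected_setP.
case=> [|x [|y [|z s]]] // _ cyc.
have Axy : [set x; y] \in A by case/andP: cyc => /andP[].
have := minA _ (cycle_edge_redundant cyc cA) (subsetDl _ _).
by move/setP/(_ [set x; y]); rewrite !inE eqxx Axy.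
Qed.

(** The differences telescope along a path. *)
Lemma connect_ideal (R : comPzRingType) (I : ideal R) (e : rel V) (f : V -> R) :
  (forall u v, e u v -> I (f u - f v)) ->
  forall u v, connect e u v -> I (f u - f v).
Proof.
move=> If u v /connectP[s es ->{v}].
elim: s u es => [|w s IHs] u /=; first by rewrite subrr => _; apply: ideal_mem0.
case/andP=> /If Iuw /IHs Iws.
by rewrite -(subrKA (f w)); apply: ideal_memD.
Qed.

End EdgeSets.

Lemma rank_one_connected (m p e : nat) (V : finType) (G : sgraph V)
    (alpha : edge_labeling G 'Z_m) (S : {set {set V}}) :
  (1 < m)%N -> prime p -> (0 < e)%N -> (p ^ e %| m)%N ->
  (forall d : edge G, ~~ (val d \in S) ->
     ~ ideal_sub (alpha d) (principal_ideal ((p ^ e)%N%:R : 'Z_m))) ->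
  rank_one alpha -> connected_set S.
Proof.
move=> m_gt1 p_pr e_gt0 pe_m labS rk1; apply/connected_setP=> u v.
apply: contraT => uNv.
have p_m : (p %| m)%N by apply: dvdn_trans pe_m; apply: dvdn_exp.
(* This [c] is nonzero because [0 < m %/ p < m], yet it lies in the label of every edge outside
   [S]. *)
pose c : 'Z_m := (m %/ p)%N%:R.
have c_neq0 : c != 0.
  rewrite -val_eqE /= val_Zp_nat // modn_small ?ltn_Pdiv ?prime_gt1 1?ltnW //.
  by rewrite -lt0n divn_gt0 ?prime_gt0 // dvdn_leq // ltnW.
(* [f] does not vary along edges of [S]; along any other edge it changes by [0], [c] or [- c]. *)
pose f w : 'Z_m := if connect (edge_rel S) u w then c else 0.
have spl_f : is_spline alpha f.
  move=> d a b def_d; have [Sd|/labS nsub] := boolP (val d \in S).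
    have Sab : edge_rel S a b by rewrite /edge_rel /= -def_d.
    rewrite /f (same_connect1r (edge_rel_connect_sym S) Sab) subrr.
    exact: ideal_mem0.
  have Ic : alpha d c by apply: ideal_natr_div_prime nsub.
  rewrite /f; do 2!case: ifP => _; rewrite ?subrr ?subr0 ?sub0r //;
    try exact: ideal_mem0.
  by rewrite -mulN1r; apply: ideal_memMl.
have /eqP := rk1 f spl_f u v.
by rewrite /f connect0 (negPf uNv) (negPf c_neq0).
Qed.

Theorem theorem4p7 (m k : nat) (p e : 'I_k -> nat)
    (m_gt1 : (1 < m)%N)
    (p_prime : forall i, prime (p i))
    (p_inj : injective p)
    (e_gt0 : forall i, (0 < e i)%N)
    (m_fact : m = (\prod_(i < k) p i ^ e i)%N)
    (V : finType) (G : sgraph V) (alpha : edge_labeling G 'Z_m) :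
  rank_one alpha <->
  exists T : 'I_k -> sgraph V,
    forall i, spanning_tree G (T i) /\
      forall d : edge G, val d \in edges (T i) ->
        ideal_sub (alpha d) (principal_ideal ((p i ^ e i)%N%:R : 'Z_m)).
Proof.
have pe_m i : (p i ^ e i %| m)%N.
  by rewrite m_fact (bigD1 i) //= dvdn_mulr.
split=> [rk1 | [T spanT] f spl_f u v]; last first.
  apply/eqP; rewrite -subr_eq0; apply/eqP/Zp_dvdn_eq0 => //.
  (* The ideals meet in 0 because a representative divisible by all the pairwise coprime [p i ^ e i]
     is divisible by [m]. *)
  rewrite {1}m_fact; apply: prod_dvdn_coprime => [i j iNj|i].
    rewrite coprimeXl ?coprimeXr ?prime_coprime ?dvdn_prime2 //.
    by rewrite (inj_eq p_inj).
  apply/(principal_dvdnP m_gt1) => //.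
  have [[sTG [cT _]] labT] := spanT i.
  apply: connect_ideal (cT u v) => a b Tab.
  have Gab := subsetP sTG _ Tab.
  by apply: (labT (exist _ [set a; b] Gab)) => //; apply: spl_f.
have tree_i i : exists Ti, spanning_tree G Ti /\
    forall d : edge G, val d \in edges Ti ->
      ideal_sub (alpha d) (principal_ideal ((p i ^ e i)%N%:R : 'Z_m)); last exact: fin_all_exists tree_i.
pose sub_label f := forall d : edge G, val d = f ->
  ideal_sub (alpha d) (principal_ideal ((p i ^ e i)%N%:R : 'Z_m)).
(* Containment of ideals is a mere [Prop]; classical reflection turns it into a boolean so that
   these edges form a finite set. *)
pose S := [set f in edges G | `[< sub_label f >]].
have cS : connected_set S.
  apply: (rank_one_connected m_gt1 (p_prime i) (e_gt0 i)) rk1 => // d + sub_d.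
  rewrite inE (valP d) => /negP; apply; apply/asboolP=> d' /val_inj-> //.
have sSG : S \subset edges G by apply/subsetP=> f; rewrite inE => /andP[].
have [T spanT sTS] := spanning_tree_exists sSG cS.
exists T; split=> // d /(subsetP sTS).
by rewrite inE => /andP[_ /asboolP]; apply.
Qed.
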